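(* Let $r$ be a positive integer. For each integer $i\geq 1$, let $A_i:\mathbb{Z}^r\to\mathbb{Z}^r$ be an injective endomorphism of $\mathbb{Z}^r$, and consider the group $$G=\bigcup_{n=0}^\infty A_1^{-1}\cdots A_n^{-1}(\mathbb{Z}^r)\subseteq\mathbb{Q}^r .$$ Then, for any prime $p$, $$G^{*p}=\bigcap_{n=0}^\infty (\mathbb{Z}_p^r)^* A_n\cdots A_1 .$$
   Context: For a ring $R$, $R^r$ is the module of $r\times 1$ columns over $R$, and $(R^r)^*$ is its dual, consisting of $1\times r$ rows over $R$. Each endomorphism $A_i$ of $\mathbb{Z}^r$ is identified with the $r\times r$ integer matrix representing it (acting by left multiplication on columns); being injective, it is invertible over $\mathbb{Q}$. The same matrix acts on $(\mathbb{Z}_p^r)^*$ by right multiplication, and $(\mathbb{Z}_p^r)^* A_n\cdots A_1=\{wA_n\cdots A_1 : w\in(\mathbb{Z}_p^r)^*\}$. For $n=0$ the products are empty, so the $n=0$ terms are $\mathbb{Z}^r$ and $(\mathbb{Z}_p^r)^*$ respectively. For a torsion-free abelian group $G$ and a prime $p$, $G^{*p}=\mathrm{Hom}(G,\mathbb{Z}_p)$ is the group of all group homomorphisms from $G$ to the $p$-adic integers ($p$-adic functionals). Since $\mathbb{Z}^r\subseteq G\subseteq\mathbb{Q}^r$, a homomorphism $G\to\mathbb{Z}_p$ is determined by its restriction to $\mathbb{Z}^r$ and is given by $g\mapsto vg$ for a unique row $v\in(\mathbb{Z}_p^r)^*$ (product computed in $\mathbb{Q}_p$). In this way $G^{*p}$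 is identified with the set of rows $v\in(\mathbb{Z}_p^r)^*$ such that $vg\in\mathbb{Z}_p$ for all $g\in G$. *)

(* Defs.v *)
From HB Require Import structures.
From mathcomp Require Import all_boot all_order all_algebra.
From mathcomp Require Import boolp classical_sets.
Set Implicit Arguments.
Unset Strict Implicit.
Unset Printing Implicit Defensive.
Import Order.TTheory GRing.Theory Num.Theory.
Local Open Scope ring_scope.

(* The ring of p-adic integers as the inverse limit of the rings Z/p^n: an    *)
(* element is a sequence of residues x_n with x_n = x_(n+1) mod p^n, which    *)
(* forces 0 <= x_n < p^n.                                                     *)
Definition padic_coherent (p : nat) (x : nat -> int) : Prop :=
  forall n, x n = (x n.+1 %% (p ^ n)%N)%Z.

Record padic_int (p : nat) (hp : prime p) := PadicInt {
  padic_res : nat -> int;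
  _ : `[< padic_coherent p padic_res >] }.

Section PadicRing.
Variables (p : nat) (hp : prime p).
Local Notation Zp := (padic_int hp).

HB.instance Definition _ := [isSub for @padic_res p hp].
HB.instance Definition _ := [Choice of Zp by <:].

Implicit Types x y z : Zp.
Local Notation q n := ((p ^ n)%N : int).

Lemma padic_resP x n : padic_res x n = (padic_res x n.+1 %% q n)%Z.
Proof. by case: x => x /= /asboolP; apply. Qed.

Lemma padic_res_mod x n : (padic_res x n %% q n)%Z = padic_res x n.
Proof. by rewrite padic_resP modz_mod. Qed.

Lemma padic_ext x y : (forall n, padic_res x n = padic_res y n) -> x = y.
Proof. by move=> exy; apply/val_inj/funext. Qed.

Lemma modz_pow (m : int) n k : ((m %% q (n + k)%N)%Z %% q n)%Z = (m %% q n)%Z.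
Proof.
by rewrite addnC [in RHS](divz_eq m (q (k + n)%N)) expnD PoszM mulrA modzMDl.
Qed.

Definition padic_mk (s : nat -> int)
    (hs : forall n, (s n.+1 = s n %[mod q n])%Z) : Zp.
Proof.
apply: (@PadicInt p hp (fun n => (s n %% q n)%Z)).
by apply/asboolP => n; rewrite -addn1 modz_pow addn1 hs.
Defined.

Lemma padic_congr x n : (padic_res x n.+1 = padic_res x n %[mod q n])%Z.
Proof. by rewrite padic_res_mod -padic_resP. Qed.

Lemma padic_const_congr (m : int) n : (m = m %[mod q n])%Z.
Proof. by []. Qed.

Lemma padic_add_congr x y n :
  (padic_res x n.+1 + padic_res y n.+1
    = padic_res x n + padic_res y n %[mod q n])%Z.
Proof. by rewrite -modzDm !padic_congr modzDm. Qed.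

Lemma padic_opp_congr x n : (- padic_res x n.+1 = - padic_res x n %[mod q n])%Z.
Proof. by rewrite -modzNm padic_congr modzNm. Qed.

Lemma padic_mul_congr x y n :
  (padic_res x n.+1 * padic_res y n.+1
    = padic_res x n * padic_res y n %[mod q n])%Z.
Proof. by rewrite -modzMm !padic_congr modzMm. Qed.

Definition padic_zero : Zp := padic_mk (padic_const_congr 0).
Definition padic_one : Zp := padic_mk (padic_const_congr 1).
Definition padic_add x y : Zp := padic_mk (padic_add_congr x y).
Definition padic_opp x : Zp := padic_mk (padic_opp_congr x).
Definition padic_mul x y : Zp := padic_mk (padic_mul_congr x y).

Fact padic_addA : associative padic_add.
Proof. by move=> x y z; apply: padic_ext => n /=; rewrite modzDmr modzDml addrA. Qed.
Fact padic_addC : commutative padic_add.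
Proof. by move=> x y; apply: padic_ext => n /=; rewrite addrC. Qed.
Fact padic_add0 : left_id padic_zero padic_add.
Proof. by move=> x; apply: padic_ext => n /=; rewrite modzDml add0r padic_res_mod. Qed.
Fact padic_addN : left_inverse padic_zero padic_opp padic_add.
Proof. by move=> x; apply: padic_ext => n /=; rewrite modzDml addNr. Qed.

HB.instance Definition _ :=
  GRing.isZmodule.Build Zp padic_addA padic_addC padic_add0 padic_addN.

Fact padic_mulA : associative padic_mul.
Proof. by move=> x y z; apply: padic_ext => n /=; rewrite modzMmr modzMml mulrA. Qed.
Fact padic_mulC : commutative padic_mul.
Proof. by move=> x y; apply: padic_ext => n /=; rewrite mulrC. Qed.
Fact padic_mul1 : left_id padic_one padic_mul.
Proof. by move=> x; apply: padic_ext => n /=; rewrite modzMml mul1r padic_res_mod. Qed.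
Fact padic_mulDl : left_distributive padic_mul padic_add.
Proof.
by move=> x y z; apply: padic_ext => n /=; rewrite modzMml modzDm mulrDl.
Qed.
Fact padic_one_neq0 : padic_one != 0.
Proof.
apply/eqP => /(congr1 (fun x => padic_res x 1)) /=; rewrite expn1 mod0z.
by rewrite modz_small // ltz_nat prime_gt1.
Qed.

HB.instance Definition _ := GRing.Zmodule_isComNzRing.Build Zp
  padic_mulA padic_mulC padic_mul1 padic_mulDl padic_one_neq0.

Definition padic_unit : pred Zp := fun x => `[< exists y, y * x = 1 >].
Definition padic_inv x : Zp :=
  if pselect (exists y, y * x = 1) is left h then projT1 (cid h) else x.

Fact padic_mulVx : {in padic_unit, left_inverse 1 padic_inv *%R}.
Proof.
move=> x /asboolP ux; rewrite /padic_inv; case: pselect => // h.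
exact: (projT2 (cid h)).
Qed.
Fact padic_unitPl x y : y * x = 1 -> x \in padic_unit.
Proof. by move=> yx; apply/asboolP; exists y. Qed.
Fact padic_inv_out : {in [predC padic_unit], padic_inv =1 id}.
Proof.
move=> x /negP nux; rewrite /padic_inv; case: pselect => // h.
by case: nux; apply/asboolP.
Qed.

HB.instance Definition _ := GRing.ComNzRing_hasMulInverse.Build Zp
  padic_mulVx padic_unitPl padic_inv_out.

Lemma padic_res_trunc x n k : (padic_res x (n + k)%N %% q n)%Z = padic_res x n.
Proof.
elim: k => [|k IHk]; first by rewrite addn0 padic_res_mod.
by rewrite -IHk addnS (padic_resP x (n + k)) modz_pow.
Qed.

Lemma padic_neq0 x : x != 0 -> exists n, padic_res x n != 0.
Proof.
move=> nzx; apply: contrapT => h; case/eqP: nzx; apply: padic_ext => n /=.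
by rewrite mod0z; apply/eqP/negPn/negP => xn; apply: h; exists n.
Qed.

Lemma dvdn_pfactor_mul m n a b :
  (p ^ (m + n) %| a * b)%N -> (p ^ m %| a)%N || (p ^ n %| b)%N.
Proof.
case: (posnP a) => [->|a0]; first by rewrite dvdn0.
case: (posnP b) => [->|b0]; first by rewrite dvdn0 orbT.
rewrite !pfactor_dvdn ?muln_gt0 ?a0 // lognM // => le_mn.
case: leqP => //= lt_am; rewrite leqNgt; apply/negP => lt_bn.
by move: le_mn; rewrite leqNgt -addnS leq_add // ltnW.
Qed.

Fact padic_integral x y : x * y = 0 -> (x == 0) || (y == 0).
Proof.
move=> xy0; apply: contraT; rewrite negb_or => /andP[/padic_neq0[m xm]].
case/padic_neq0=> n yn.
have /(congr1 (fun z : Zp => padic_res z (m + n))) /= := xy0.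
rewrite mod0z => /dvdz_mod0P dv.
have : ((p ^ (m + n))%N %| `|padic_res x (m + n)| * `|padic_res y (m + n)|)%N.
  by rewrite -abszM.
case/dvdn_pfactor_mul/orP => [dx|dy].
  by case/negP: xm; rewrite -(padic_res_trunc x m n); apply/eqP/dvdz_mod0P.
by case/negP: yn; rewrite -(padic_res_trunc y n m) addnC; apply/eqP/dvdz_mod0P.
Qed.

HB.instance Definition _ := GRing.ComUnitRing_isIntegral.Build Zp padic_integral.

End PadicRing.

Notation padic_rat hp := {fraction (padic_int hp)}.

Definition padic_dual (p : nat) (hp : prime p) (G : zmodType) : Type :=
  {additive G -> padic_int hp}.

Section DirectLimit.
Variables (r : nat) (A : nat -> 'M[int]_r).

(* A_n ... A_1; the value of A at 0 is never used. *)
Fixpoint fwd_prod (n : nat) : 'M[int]_r :=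
  if n is m.+1 then A m.+1 *m fwd_prod m else 1%:M.

(* A_1^-1 ... A_n^-1 over the rationals. *)
Fixpoint inv_prod (n : nat) : 'M[rat]_r :=
  if n is m.+1 then inv_prod m *m invmx (map_mx intr (A m.+1)) else 1%:M.

Definition limit_set : set 'cV[rat]_r :=
  (\bigcup_(n in [set: nat])
     [set inv_prod n *m map_mx intr z | z in [set: 'cV[int]_r]])%classic.

Definition injective_seq : Prop :=
  forall i, (0 < i)%N -> injective (fun z : 'cV[int]_r => A i *m z).

Hypothesis hA : injective_seq.

Lemma unitmx_rat i : (0 < i)%N -> map_mx intr (A i) \in @unitmx rat r.
Proof.
move=> i0; rewrite unitmxE det_map_mx unitfE intr_eq0 -det_tr.
apply/det0P => -[v nzv vA]; case/eqP: nzv; apply/trmx_inj/(hA i0).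
by rewrite trmx0 mulmx0 -[LHS]trmxK trmx_mul trmxK vA trmx0.
Qed.

Lemma limit_set_mono m k (z : 'cV[int]_r) :
  exists t : 'cV[int]_r,
    inv_prod m *m map_mx intr z = inv_prod (m + k) *m map_mx intr t.
Proof.
elim: k => [|k [t ->]]; first by exists z; rewrite addn0.
exists (A (m + k).+1 *m t); rewrite addnS /= map_mxM -mulmxA.
by rewrite mulKmx // unitmx_rat.
Qed.

Lemma limit_set_zmod : zmod_closed [pred g | `[< limit_set g >]].
Proof.
split; first by apply/asboolP; exists 0%N => //; exists 0; rewrite // map_mx0 mulmx0.
move=> g h /asboolP[m _ [z _ <-]] /asboolP[n _ [t _ <-]]; apply/asboolP.
have [z' ->] := limit_set_mono m n z; have [t' ->] := limit_set_mono n m t.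
exists (m + n)%N => //; exists (z' - t') => //.
by rewrite map_mxB mulmxBr [(n + m)%N]addnC.
Qed.

End DirectLimit.

(* The group G: the proof that the A_i are injective is a parameter of the    *)
(* type because it is what makes the union a subgroup.                        *)
Definition limit_pred r A (hA : @injective_seq r A) : {pred 'cV[rat]_r} :=
  [pred g | `[< limit_set A g >]].

HB.instance Definition _ r A (hA : @injective_seq r A) :=
  GRing.isZmodClosed.Build 'cV[rat]_r (limit_pred hA) (limit_set_zmod hA).

Record limit_group r A (hA : @injective_seq r A) := LimitGroup {
  limit_val : 'cV[rat]_r;
  _ : limit_val \in limit_pred hA }.

Section LimitGroup.
Variables (r : nat) (A : nat -> 'M[int]_r) (hA : injective_seq A).

HB.instance Definition _ := [isSub for @limit_val r A hA].
HB.instance Definition _ := [Choice of limit_group hA by <:].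
HB.instance Definition _ := [SubChoice_isSubZmodule of limit_group hA by <:].

End LimitGroup.

(* The product v g of a row over Z_p and a column over Q, computed in Q_p.    *)
Definition padic_pairing p (hp : prime p) r
    (v : 'rV[padic_int hp]_r) (g : 'cV[rat]_r) : padic_rat hp :=
  (map_mx (@tofrac _) v *m map_mx ratr g) 0 0.

Definition functional_of_row p (hp : prime p) r A (hA : @injective_seq r A)
    (f : padic_dual hp (limit_group hA)) (v : 'rV[padic_int hp]_r) : Prop :=
  forall g : limit_group hA, tofrac (f g) = padic_pairing v (limit_val g).

(* G^{*p}, identified with a set of rows. *)
Definition padic_dual_rows p (hp : prime p) r A (hA : @injective_seq r A) :
    set 'rV[padic_int hp]_r :=
  [set v | exists f : padic_dual hp (limit_group hA), functional_of_row f v]%classic.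

Arguments padic_dual_rows {p} hp {r A} hA.

(* Every functional is given by exactly one row, which is what makes the      *)
(* identification of G^{*p} with padic_dual_rows legitimate.                  *)
Section Identification.
Variables (p : nat) (hp : prime p).
Local Notation Qp := (padic_rat hp).

Lemma padic_int_nat_neq0 (d : nat) : (0 < d)%N -> d%:R != 0 :> padic_int hp.
Proof.
move=> d0; apply/eqP => /(congr1 (fun x => padic_res x d)).
have resE k : padic_res (k%:R : padic_int hp) d = (k %% (p ^ d)%N)%Z.
  elim: k => [|k IHk]; first by rewrite /= !mod0z.
  rewrite -addn1 natrD /= IHk.
  by rewrite modzDm.
rewrite resE /= mod0z modz_small; first by case: d d0 {resE}.
by rewrite lez_nat ltz_nat /= ltn_expl // prime_gt1.
Qed.

Lemma padic_rat_int_neq0 (m : int) : m != 0 -> m%:~R != 0 :> Qp.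
Proof.
have nat_neq0 k : (0 < k)%N -> k%:R != 0 :> Qp.
  by move=> k0; rewrite -(rmorph_nat (@tofrac _)) tofrac_eq0 padic_int_nat_neq0.
case: m => [[|k]|k] // _; first exact: nat_neq0.
by rewrite NegzE rmorphN oppr_eq0; apply: nat_neq0.
Qed.

Lemma ratr_intM (F : fieldType) (x : rat) (d z : int) :
  (denq x)%:~R != 0 :> F -> x * d%:~R = z%:~R -> ratr x * d%:~R = z%:~R :> F.
Proof.
move=> nzq xdz; apply: (mulIf nzq); rewrite /ratr mulrAC divfK // -!intrM.
by congr (_%:~R); apply: (@intr_inj rat); rewrite !intrM -xdz mulrAC -numqE.
Qed.

Variables (r : nat) (A : nat -> 'M[int]_r) (hA : injective_seq A).

Fact limit_int_subproof (z : 'cV[int]_r) : map_mx intr z \in limit_pred hA.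
Proof. by apply/asboolP; exists 0%N => //; exists z; rewrite // mul1mx. Qed.

Definition limit_int z : limit_group hA := LimitGroup (limit_int_subproof z).

Lemma limit_valMz (g : limit_group hA) (d : int) :
  limit_val (g *~ d) = d%:~R *: limit_val g.
Proof. by rewrite scaler_int -(raddfMz val). Qed.

Lemma limit_intE (z : 'cV[int]_r) :
  limit_int z = \sum_j limit_int (delta_mx j 0) *~ z j 0.
Proof.
apply: val_inj; rewrite (raddf_sum val) /=; apply/colP => i.
rewrite summxE (bigD1 i) //= big1 => [|j ne_ji].
  by rewrite limit_valMz !mxE !eqxx mulr1 addr0.
by rewrite limit_valMz !mxE eq_sym (negPf ne_ji) mulr0.
Qed.

Lemma limit_denom (g : 'cV[rat]_r) :
  exists2 d : int, d != 0 & exists z : 'cV[int]_r, d%:~R *: g = map_mx intr z.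
Proof.
exists (\prod_j denq (g j 0)); first by apply/prodf_neq0 => j _; rewrite denq_neq0.
exists (\col_j (numq (g j 0) * \prod_(i | i != j) denq (g i 0))).
apply/colP => j; rewrite !mxE (bigD1 j) //= !intrM mulrAC; congr (_ * _).
by rewrite mulrC numqE.
Qed.

Lemma padic_pairing_int (v : 'rV[padic_int hp]_r) (z : 'cV[int]_r) :
  padic_pairing v (map_mx intr z) = \sum_j tofrac (v 0 j) * (z j 0)%:~R.
Proof. by rewrite /padic_pairing mxE; apply: eq_bigr => j _; rewrite !mxE ratr_int. Qed.

Lemma functional_of_row_unique (f : padic_dual hp (limit_group hA)) :
  exists! v, functional_of_row f v.
Proof.
exists (\row_j f (limit_int (delta_mx j 0))); split=> [g|v fv]; last first.
  apply/rowP => j; rewrite mxE; apply/eqP; rewrite -tofrac_eq; apply/eqP.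
  rewrite (fv (limit_int _)) padic_pairing_int (bigD1 j) //= big1 => [|i ne_ij].
    by rewrite mxE !eqxx mulr1 addr0.
  by rewrite mxE (negPf ne_ij) mulr0.
have [d nzd [z dgz]] := limit_denom (limit_val g).
apply: (mulIf (padic_rat_int_neq0 nzd)).
have dg : g *~ d = limit_int z by apply: val_inj; rewrite /= limit_valMz dgz.
transitivity (\sum_j tofrac (f (limit_int (delta_mx j 0))) * (z j 0)%:~R : Qp).
  rewrite mulrzr -(raddfMz (@tofrac _)) -(raddfMz f) dg limit_intE !raddf_sum.
  by apply: eq_bigr => j _; rewrite !raddfMz mulrzr.
rewrite /padic_pairing mxE mulr_suml; apply: eq_bigr => j _; rewrite !mxE -mulrA.
congr (_ * _); apply/esym; apply: ratr_intM; first by rewrite padic_rat_int_neq0 ?denq_neq0.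
by move/colP/(_ j): dgz; rewrite !mxE mulrC.
Qed.

End Identification.

(* Main.v *)
Require Import Defs.
From HB Require Import structures.
From mathcomp Require Import all_boot all_order all_algebra.
From mathcomp Require Import boolp classical_sets.
Set Implicit Arguments.
Unset Strict Implicit.
Unset Printing Implicit Defensive.
Import Order.TTheory GRing.Theory Num.Theory.
Local Open Scope ring_scope.
Local Open Scope classical_set_scope.

(** Write P_n = A_n ... A_1, so that G is the increasing union of the lattices
    P_n^-1 Z^r.  A row v defines a functional on P_n^-1 Z^r exactly when the row
    w = v P_n^-1 over Q_p has entries in Z_p, that is when v = w P_n with w over
    Z_p; letting n vary gives the intersection.

    If v comes from a functional f, then w is the row of values of f at the
    columns of P_n^-1, and v = w P_n because f is additive and
    P_n^-1 (P_n e_k) = e_k ([dual_row_divisible]).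

    Conversely, if v = w P_n and g = P_n^-1 z, then v g = w z lies in Z_p
    ([divisible_row_integral]), so v takes integral values on all of G; these
    values form a functional since the pairing is additive
    ([functional_of_integral_row]).  Identities in Q_p between pairings are
    checked after multiplication by a common denominator, which turns them into
    identities between products of matrices over Z_p ([padic_pairing_denom]). *)

Lemma map_intr_inj (m n : nat) :
  injective (map_mx intr : 'M[int]_(m, n) -> 'M[rat]_(m, n)).
Proof.
move=> B C /matrixP eqBC; apply/matrixP => i j; apply: (@intr_inj rat).
by have := eqBC i j; rewrite !mxE.
Qed.

Lemma inv_prodK (r : nat) (A : nat -> 'M[int]_r) (hA : injective_seq A) n :
  inv_prod A n *m map_mx intr (fwd_prod A n) = 1%:M.
Proof.
elim: n => [|n IHn] /=; first by rewrite map_mx1 mulmx1.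
by rewrite map_mxM mulmxA mulmxKV ?unitmx_rat.
Qed.

Lemma fwd_prodK (r : nat) (A : nat -> 'M[int]_r) (hA : injective_seq A) n :
  map_mx intr (fwd_prod A n) *m inv_prod A n = 1%:M.
Proof. exact/mulmx1C/inv_prodK. Qed.

Section Pairing.
Variables (p : nat) (hp : prime p) (r : nat).
Implicit Types (v w : 'rV[padic_int hp]_r) (g h : 'cV[rat]_r).

Lemma padic_pairing_intE v (z : 'cV[int]_r) :
  padic_pairing v (map_mx intr z) = tofrac ((v *m map_mx intr z) 0 0).
Proof.
rewrite padic_pairing_int mxE raddf_sum; apply: eq_bigr => j _.
by rewrite /= mxE rmorphM rmorph_int.
Qed.

(** Clearing denominators of g moves its pairings from Q_p to Z_p, where
    matrix algebra applies. *)
Lemma padic_pairing_denom v g (d : int) (z : 'cV[int]_r) :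
  d%:~R *: g = map_mx intr z ->
  padic_pairing v g * d%:~R = tofrac ((v *m map_mx intr z) 0 0).
Proof.
move=> dgz; rewrite -padic_pairing_intE padic_pairing_int.
rewrite /padic_pairing mxE mulr_suml; apply: eq_bigr => j _.
rewrite !mxE -mulrA; congr (_ * _).
apply: ratr_intM; first by rewrite padic_rat_int_neq0 ?denq_neq0.
by move/colP/(_ j): dgz; rewrite !mxE mulrC.
Qed.

Lemma padic_pairingB v g h :
  padic_pairing v (g - h) = padic_pairing v g - padic_pairing v h.
Proof.
have [d nzd [z dgz]] := limit_denom g; have [e nze [t eht]] := limit_denom h.
apply: (mulIf (padic_rat_int_neq0 hp (mulf_neq0 nzd nze))).
have gE : (d * e)%:~R *: g = map_mx intr (e *: z) :> 'cV[rat]_r.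
  by rewrite map_mxZ -dgz scalerA -intrM mulrC.
have hE : (d * e)%:~R *: h = map_mx intr (d *: t) :> 'cV[rat]_r.
  by rewrite map_mxZ -eht scalerA -intrM.
have ghE : (d * e)%:~R *: (g - h) = map_mx intr (e *: z - d *: t) :> 'cV[rat]_r.
  by rewrite map_mxB -gE -hE scalerBr.
rewrite mulrBl (padic_pairing_denom _ ghE).
rewrite (padic_pairing_denom _ gE) (padic_pairing_denom _ hE).
by rewrite -rmorphB map_mxB mulmxBr !mxE.
Qed.

End Pairing.

Section Functionals.
Variables (p : nat) (hp : prime p) (r : nat).
Variables (A : nat -> 'M[int]_r) (hA : injective_seq A).

Lemma limit_inv_subproof n (z : 'cV[int]_r) :
  inv_prod A n *m map_mx intr z \in limit_pred hA.
Proof. by apply/asboolP; exists n => //; exists z. Qed.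

Definition limit_inv n z : limit_group hA := LimitGroup (limit_inv_subproof n z).

(** The columns of the inverse of A_n ... A_1 lie in G, and the values of the
    functional there are the entries of the quotient row w. *)
Lemma dual_row_divisible (f : padic_dual hp (limit_group hA)) v n :
  functional_of_row f v ->
  exists w, w *m map_mx intr (fwd_prod A n) = v.
Proof.
move=> fv; exists (\row_j f (limit_inv n (delta_mx j 0))); apply/rowP => k.
apply/eqP; rewrite -tofrac_eq; apply/eqP.
have -> : tofrac (v 0 k) = tofrac (f (limit_int hA (delta_mx k 0))).
  rewrite fv padic_pairing_intE; congr (tofrac _).
  by rewrite map_delta_mx -colE mxE.
(* e_k is P_n^-1 applied to the k-th column of P_n. *)
have -> : limit_int hA (delta_mx k 0) =
    \sum_j limit_inv n (delta_mx j 0) *~ fwd_prod A n j k.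
  apply: val_inj; rewrite (raddf_sum val) /=.
  rewrite -[LHS]mul1mx -(inv_prodK hA n) -mulmxA.
  under eq_bigr => j _ do rewrite limit_valMz /= map_delta_mx -colE.
  rewrite map_delta_mx -colE; apply/colP => i; rewrite summxE !mxE.
  by apply: eq_bigr => j _; rewrite !mxE mulrC.
rewrite raddf_sum mxE; congr (tofrac _); apply: eq_bigr => j _.
by rewrite !mxE raddfMz mulrzr.
Qed.

(** Regroup (w P_n) (P_n^-1 z) as w z.  With d a denominator of
    g = P_n^-1 z and t = d g, this is the identity w (P_n t) = w (d z) over Z_p,
    since P_n t = d z already holds over Z. *)
Lemma divisible_row_integral (w : 'rV[padic_int hp]_r) n (z : 'cV[int]_r) :
  padic_pairing (w *m map_mx intr (fwd_prod A n))
      (inv_prod A n *m map_mx intr z)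
    = tofrac ((w *m map_mx intr z) 0 0).
Proof.
set g := inv_prod A n *m _; have [d nzd [t dgt]] := limit_denom g.
apply: (mulIf (padic_rat_int_neq0 hp nzd)).
have Pt : fwd_prod A n *m t = d *: z.
  apply: map_intr_inj.
  by rewrite map_mxM map_mxZ -dgt -scalemxAr mulmxA fwd_prodK // mul1mx.
rewrite (padic_pairing_denom _ dgt) -mulmxA -map_mxM Pt map_mxZ.
by rewrite -scalemxAr mxE rmorphM rmorph_int mulrC.
Qed.

(** Z_p embeds in Q_p, so the integral values of the pairing are unique and
    inherit its additivity. *)
Lemma functional_of_integral_row (v : 'rV[padic_int hp]_r) :
  (forall g : limit_group hA, exists x, tofrac x = padic_pairing v (limit_val g)) ->
  exists f : padic_dual hp (limit_group hA), functional_of_row f v.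
Proof.
move=> /choice[f fv].
have fB : zmod_morphism f.
  move=> g h; apply/eqP; rewrite -tofrac_eq; apply/eqP.
  by rewrite tofracB !fv -padic_pairingB -(raddfB val).
pose F := GRing.isZmodMorphism.Build _ _ f fB.
pose f' : {additive limit_group hA -> padic_int hp} := HB.pack f F.
by exists f'.
Qed.

End Functionals.

Theorem proposition2p1 (r : nat) (hr : (0 < r)%N) (A : nat -> 'M[int]_r)
  (hA : forall i : nat, (0 < i)%N -> injective (fun z : 'cV[int]_r => A i *m z))
  (p : nat) (hp : prime p) :
  padic_dual_rows hp hA =
  \bigcap_(n in [set: nat])
    [set w *m map_mx intr (fwd_prod A n) | w in [set: 'rV[padic_int hp]_r]].
Proof.
apply/seteqP; split=> [v [f fv] n _|v divv].
  by have [w <-] := dual_row_divisible n fv; exists w.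
apply: functional_of_integral_row => -[g Gg] /=.
case/asboolP: (Gg) => n _ [z _ <-]; have [w _ <-] := divv n I.
by exists ((w *m map_mx intr z) 0 0); rewrite divisible_row_integral.
Qed.
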